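(* Let $d\geq 2$, let $t\in\mathbb{R}^d$, and let $L\subset\mathbb{R}^d$ be a (full) lattice. Furthermore, let $R>0$. Then: (a) The set $\mathcal{D}_{<R}(t+L)$ is determined by two $X$-rays in $L$-directions. (b) The set $\mathcal{D}_{<R}(t+L)$ is determined by two projections on orthogonal complements of $1$-dimensional $L$-subspaces.
   Context: $\mathcal{D}_{<R}(S)$ is the set of all subsets of $S\subset\mathbb{R}^d$ of diameter less than $R$ (finite sets when $S=t+L$). A direction is an element of the unit sphere $\mathbb{S}^{d-1}$; an $L$-direction is a direction parallel to a non-zero element of $L-L=L$; an $L$-subspace is a linear subspace of $\mathbb{R}^d$ generated by elements of $L$. For a finite $F\subset\mathbb{R}^d$ and a direction $u$, the $X$-ray $X_uF$ is the function assigning to each line $\ell$ in $\mathbb{R}^d$ parallel to $u$ the number $\operatorname{card}(F\cap\ell)$. For a linear subspace $T$, $F|T^\perp$ denotes the orthogonal projection (canonical inner product) of $F$ on $T^\perp$. A collection $\mathcal{E}$ of finite subsets of $\mathbb{R}^d$ is determined by $m$ $X$-rays in $L$-directions if there is a set $U$ of $m$ pairwise non-parallel $L$-directions such that for all $F,F'\in\mathcal{E}$: $(X_uF=X_uF'\ \forall u\in U)\Rightarrow F=F'$. It is determined by $m$ projections on orthogonal complements of $1$-dimensional $L$-subspaces if there is a set $\mathcal{T}$ of $m$ pairwise non-parallel $1$-dimensional $L$-subspaces such that for all $F,F'\in\mathcal{E}$: $(F|T^\perp=F'|T^\perp\ \forall T\in\mathcal{T})\Rightarrow F=F'$. *)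

(* Defs.v *)
From HB Require Import structures.
From mathcomp Require Import all_boot all_order all_algebra.
From mathcomp Require Import finmap.
From mathcomp Require Import all_classical all_reals all_analysis.
Set Implicit Arguments.
Unset Strict Implicit.
Unset Printing Implicit Defensive.
Import Order.TTheory GRing.Theory Num.Theory.
Local Open Scope classical_set_scope.
Local Open Scope card_scope.
Local Open Scope ring_scope.

Section Defs.
Variables (R : realType) (d : nat).
Local Notation V := 'rV[R]_d.
Implicit Types (x y u v : V) (S L F : set V) (T : {vspace V}).

Definition dot x y : R := \sum_(i < d) x 0 i * y 0 i.

(* The norm `|x| that the library puts on 'rV[R]_d is the sup norm. *)
Definition enorm x : R := Num.sqrt (dot x x).

(* Under the convention ereal_sup set0 = -oo, the empty set has diameter -oo. *)
Definition diam S : \bar R :=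
  ereal_sup [set (enorm (p.1 - p.2))%:E | p in S `*` S].

Definition diam_lt (r : R) S : set (set V) :=
  [set F | F `<=` S /\ (diam F < r%:E)%E].

Definition translate (t : V) S : set V := [set t + x | x in S].

(* The integer combinations of the rows of a basis matrix B. *)
Definition full_lattice L : Prop :=
  exists2 B : 'M[R]_d, B \in unitmx &
    L = [set map_mx intr z *m B | z in [set: 'rV[int]_d]].

Definition parallel u v : Prop := exists2 c : R, c != 0 & u = c *: v.

Definition direction : set V := [set u | enorm u = 1].

Definition L_direction L : set V :=
  [set u | direction u /\ exists v, [/\ L v, v != 0 & parallel u v]].

Definition line (p u : V) : set V := [set p + c *: u | c in [set: R]].

Definition lines u : set (set V) := [set line p u | p in [set: V]].

(* fset_set takes a junk value on infinite sets, so this is only meaningful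
   when F is finite. *)
Definition xray u F : lines u -> nat :=
  fun l => #|` fset_set (F `&` set_val l)|%fset.

Definition subspace_generated_by L T : Prop :=
  exists2 X : seq V, (forall x, x \in X -> L x) & T = <<X>>%VS.

(* Two subspaces are parallel when one of them contains the other; in equal
   dimension this means that they coincide. *)
Definition parallel_subspaces T T' : Prop := (T <= T')%VS \/ (T' <= T)%VS.

Definition orth_compl T : set V :=
  [set y | forall x, x \in T -> dot x y = 0].

Definition is_orth_proj (W : set V) x y : Prop :=
  W y /\ forall w, W w -> dot (x - y) w = 0.

Definition orth_proj_set (W : set V) F : set V :=
  [set y | exists2 x, F x & is_orth_proj W x y].

Definition determined_by_xrays L (E : set (set V)) (m : nat) : Prop :=
  (forall F, E F -> finite_set F) /\
  exists U : set V,
    [/\ U #= `I_m,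
        U `<=` L_direction L,
        forall u v, U u -> U v -> u != v -> ~ parallel u v
      & forall F F', E F -> E F' ->
          (forall u, U u -> @xray u F = @xray u F') -> F = F'].

Definition determined_by_projections L (E : set (set V)) (m : nat) : Prop :=
  (forall F, E F -> finite_set F) /\
  exists TT : set {vspace V},
    [/\ TT #= `I_m,
        forall T, TT T -> \dim T = 1%N /\ subspace_generated_by L T,
        forall T T', TT T -> TT T' -> T != T' -> ~ parallel_subspaces T T'
      & forall F F', E F -> E F' ->
          (forall T, TT T ->
             orth_proj_set (orth_compl T) F = orth_proj_set (orth_compl T) F') ->
          F = F'].

End Defs.

(* Main.v *)
Require Import Defs.
From mathcomp Require Import all_boot all_order all_algebra.
From mathcomp Require Import finmap zify lra.
From mathcomp Require Import all_classical all_reals all_analysis.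
Import Order.TTheory GRing.Theory Num.Theory.
Local Open Scope classical_set_scope.
Local Open Scope ring_scope.

(** Let [v1], [v2] be lattice vectors such that a difference
[a *: v1 - b *: v2] of two lattice vectors parallel to [v1] and [v2] is either
trivial ([a = b = 0]) or of length at least [r]; such a pair is called
[separated] below.  Let [F] and [F'] be subsets of [t + L] of diameter less than
[r] whose X-rays, or whose projections, along [v1] and [v2] agree.  Every point
[x] of [F] then has a point [x + a *: v1] of [F'] on its line parallel to [v1],
and a point [x + b *: v2] of [F'] on its line parallel to [v2].  Both shifts are
lattice vectors, and their difference joins two points of [F'], so it is shorter
than [r].  Separation gives [a = b = 0]: the point [x] itself is in [F']
([separated_sub]).  By symmetry [F = F'].  Only the bounds on the individual
diameters enter: [F] and [F'] may be far apart.

A separated pair exists for every [r] ([separated_exists]).  If [b0], [b1] are two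
vectors of a lattice basis and [M] is an integer, take [v1 = b0 + M b1] and
[v2 = - M b0 + b1].  Each has a coordinate 1, so the multiples of [v1] or [v2]
in [L] are the integer ones, and [p v1 - q v2] has coordinates [p + q M] and
[p M - q], the sum of whose squares is [(p^2 + q^2) (1 + M^2)].  For large [M]
this exceeds what a vector of length less than [r] allows, unless [p = q = 0]. *)

(** * Euclidean geometry of lines: projections and X-rays *)

Section Euclidean.
Set Implicit Arguments.
Unset Strict Implicit.
Context {R : realType} {d : nat}.
Implicit Types (x y u v w : 'rV[R]_d) (F : set 'rV[R]_d).

Lemma dotC x y : dot x y = dot y x.
Proof. by apply: eq_bigr => i _; rewrite mulrC. Qed.

Lemma dotDl x y v : dot (x + y) v = dot x v + dot y v.
Proof. by rewrite -big_split; apply: eq_bigr => i _; rewrite mxE mulrDl. Qed.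

Lemma dotZl (c : R) x y : dot (c *: x) y = c * dot x y.
Proof. by rewrite /dot mulr_sumr; apply: eq_bigr => i _; rewrite mxE mulrA. Qed.

Lemma dotBl x y v : dot (x - y) v = dot x v - dot y v.
Proof. by rewrite -(scaleN1r y) dotDl dotZl mulN1r. Qed.

Lemma dotZr (c : R) x y : dot x (c *: y) = c * dot x y.
Proof. by rewrite dotC dotZl dotC. Qed.

Lemma sqr_coord_le_dot x j : x 0 j ^+ 2 <= dot x x.
Proof.
rewrite /dot (bigD1 j) //= -expr2 lerDl.
by apply: sumr_ge0 => i _; rewrite -expr2 sqr_ge0.
Qed.

Lemma dot_ge0 x : 0 <= dot x x.
Proof. by apply: sumr_ge0 => i _; rewrite -expr2 sqr_ge0. Qed.

Lemma dot_eq0 x : dot x x = 0 -> x = 0.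
Proof.
move=> x0; apply/rowP => j; rewrite mxE; apply/eqP; rewrite -sqrf_eq0.
by rewrite eq_le sqr_ge0 andbT -x0 sqr_coord_le_dot.
Qed.

Lemma coord_le_enorm x j : `|x 0 j| <= enorm x.
Proof. by rewrite -sqrtr_sqr ler_wsqrtr // sqr_coord_le_dot. Qed.

Lemma enorm0 : enorm (0 : 'rV[R]_d) = 0.
Proof. by rewrite /enorm -(scale0r 0) dotZl mul0r sqrtr0. Qed.

Lemma enorm_neq0 x : x != 0 -> enorm x != 0.
Proof.
apply: contra_neq => /eqP; rewrite sqrtr_eq0 => x0; apply: dot_eq0.
by apply/eqP; rewrite eq_le x0 dot_ge0.
Qed.

Lemma enorm_normalize x : x != 0 -> enorm ((enorm x)^-1 *: x) = 1.
Proof.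
move=> /enorm_neq0 x0.
have xx : dot x x = enorm x ^+ 2 by rewrite sqr_sqrtr ?dot_ge0.
move: (enorm x) x0 xx => e x0 xx.
by rewrite /enorm dotZl dotZr xx expr2 mulKf // mulVf // sqrtr1.
Qed.

Lemma enorm_lt_diam (r : R) F x y :
  (diam F < r%:E)%E -> F x -> F y -> enorm (x - y) < r.
Proof.
move=> Fr Fx Fy; rewrite -lte_fin; apply: le_lt_trans Fr.
by apply: ereal_sup_ubound; exists (x, y).
Qed.

Lemma dot_reject x v : v != 0 -> dot (x - (dot x v / dot v v) *: v) v = 0.
Proof.
move=> v0; rewrite dotBl dotZl divfK ?subrr //.
by apply: contra_neq v0; exact: dot_eq0.
Qed.

Lemma orth_compl_line v w : orth_compl <[v]>%VS w <-> dot w v = 0.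
Proof.
split=> [wv|wv _ /vlineP[k ->]]; first by rewrite dotC; exact/wv/memv_line.
by rewrite dotZl dotC wv mulr0.
Qed.

(** The fibres of the orthogonal projection along a line are the translates of
that line: [x] has a projection [y]; if [y] is also a projection of [x'], then
[y] and the projection [y'] of [x'] given by the explicit formula differ by a
vector orthogonal to the line and to itself, so [x] and [x'] are both on
[y + <[v]>]. *)
Lemma eq_orth_proj_line v F F' x : v != 0 ->
  orth_proj_set (orth_compl <[v]>%VS) F
    = orth_proj_set (orth_compl <[v]>%VS) F' ->
  F x -> exists c : R, F' (x + c *: v).
Proof.
move=> v0 FF' Fx; set k := dot x v / dot v v.
have : orth_proj_set (orth_compl <[v]>%VS) F (x - k *: v).
  exists x => //; split=> [|w /orth_compl_line wv].
    exact/orth_compl_line/dot_reject.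
  by rewrite subKr dotZl dotC wv mulr0.
rewrite FF' => -[x' Fx' [/orth_compl_line yv yorth]].
set k' := dot x' v / dot v v.
have y'v := dot_reject x' v0; rewrite -/k' in y'v.
set y := x - k *: v in yv yorth; set y' := x' - k' *: v in y'v.
have wv : dot (y' - y) v = 0 by rewrite dotBl yv y'v subrr.
have y'y : y' - y = 0.
  have yE : y' - y = (x' - y) - k' *: v by rewrite addrAC.
  apply: dot_eq0; rewrite {1}yE dotBl yorth; last exact/orth_compl_line.
  by rewrite dotZl dotC wv mulr0 subrr.
exists (k' - k); suff -> : x + (k' - k) *: v = x' by [].
move/eqP: y'y; rewrite subr_eq0 /y' subr_eq /y => /eqP ->.
by rewrite scalerBl addrA addrAC.
Qed.

Lemma xray_gt0 u F (l : lines u) : finite_set F ->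
  (0 < xray F l)%N <-> exists2 x, F x & set_val l x.
Proof.
move=> Ff; have Flf : finite_set (F `&` set_val l) by exact: finite_setIl.
rewrite /xray cardfs_gt0; split=> [/fset0Pn[x]|[x Fx lx]].
  by rewrite in_fset_set // inE => -[Fx lx]; exists x.
by apply/fset0Pn; exists x; rewrite in_fset_set // inE.
Qed.

(** A line meets [F] exactly when its X-ray value is positive, so equal X-rays
give the same shifts along [u] as equal projections do. *)
Lemma eq_xray u F F' x : finite_set F -> finite_set F' ->
  @xray R d u F = @xray R d u F' -> F x -> exists c : R, F' (x + c *: u).
Proof.
move=> Ff F'f FF' Fx.
have lP : line x u \in lines u by rewrite inE; exists x.
pose l : lines u := exist _ (line x u) lP.
have : (0 < xray F l)%N.
  apply/xray_gt0 => //; exists x => //.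
  by exists 0 => //; rewrite scale0r addr0.
by rewrite FF' => /(xray_gt0 _ F'f)[y F'y [c _ cE]]; exists c; rewrite cE.
Qed.

End Euclidean.

Lemma card_eq_set2 (T : choiceType) (a b : T) :
  a != b -> ([set a; b] #= `I_2)%card.
Proof.
move=> ab; have -> : [set a; b] = [set` [fset a; b]%fset].
  apply/seteqP; split=> x /=; rewrite !inE.
    by case=> ->; rewrite eqxx ?orbT.
  by case/orP => /eqP ->; [left|right].
by apply/card_eq_fsetP; rewrite cardfs2 ab.
Qed.

(** * Separated pairs of lattice vectors *)

Section Lattice.
Set Implicit Arguments.
Unset Strict Implicit.
Context {R : realType} {d : nat}.
Implicit Types (x y u v w : 'rV[R]_d) (F L : set 'rV[R]_d) (r : R).

(** Applied to the inverse of a basis matrix of a lattice, this bounds the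
integer coordinates of a lattice vector by its length. *)
Lemma mulmx_coord_le (A : 'M[R]_d) :
  exists2 C : R, 0 <= C & forall w j, `|(w *m A) 0 j| <= C * enorm w.
Proof.
exists (\sum_i \sum_j `|A i j|) => [|w j].
  by apply: sumr_ge0 => i _; apply: sumr_ge0.
rewrite mxE mulr_suml; apply: le_trans (ler_norm_sum _ _ _) _.
apply: ler_sum => i _; rewrite normrM mulrC.
apply: ler_pM => //; last exact: coord_le_enorm.
by rewrite (bigD1 j) //= lerDl sumr_ge0.
Qed.

Lemma full_latticeB L x y : full_lattice L -> L x -> L y -> L (x - y).
Proof.
move=> [B _ ->] [z _ <-] [z' _ <-]; exists (z - z') => //.
by rewrite map_mxB mulmxBl.
Qed.

Lemma finite_diam_lt L t r F :
  full_lattice L -> diam_lt r (translate t L) F -> finite_set F.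
Proof.
move=> hL [Ft Fr]; have [B Bu LB] := hL.
have [->//|/set0P[x0 Fx0]] := eqVneq F set0.
have [C C0 CP] := mulmx_coord_le (invmx B).
set M := Num.bound (C * r).
(* The coordinates of [x - x0] lie in [-M, M]; shifted by [M] they fit into an
   ordinal, so [F] lies in the image of a finite type. *)
pose f (s : 'rV['I_(M + M).+1]_d) : 'rV[R]_d :=
  x0 + map_mx (fun k : 'I_(M + M).+1 => (k%:Z - M%:Z)%:~R) s *m B.
suff /sub_finite_set : F `<=` f @` [set: _].
  by apply; exact/finite_image/finite_finset.
move=> x Fx; have [y Ly yx] := Ft _ Fx; have [y0 Ly0 yx0] := Ft _ Fx0.
have : L (x - x0).
  rewrite -yx -yx0 opprD addrACA subrr add0r; exact: full_latticeB.
rewrite LB => -[z _ zx].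
have zM j : (`|z 0 j| <= M%:Z)%R.
  have := CP (x - x0) j; rewrite -{1}zx mulmxK // mxE -intr_norm => zC.
  rewrite -(ler_int R); apply: (le_trans zC); apply: ltW.
  apply: le_lt_trans (archi_boundP _).
    by apply: ler_wpM2l => //; apply/ltW/(enorm_lt_diam Fr).
  rewrite mulr_ge0 //; apply: ltW; apply: le_lt_trans (enorm_lt_diam Fr Fx Fx).
  exact: sqrtr_ge0.
exists (map_mx (fun k => inord `|k + M%:Z|) z) => //.
rewrite /f -map_mx_comp.
apply: (addrI (- x0)); rewrite addKr (addrC _ x) -zx; congr (_ *m B).
apply/rowP => j; rewrite !mxE /= inordK.
  by congr (_%:~R); have := zM j; lia.
by have := zM j; lia.
Qed.

(** The coefficients [a] and [b] are real, so the condition also says something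
about how [v1] and [v2] sit in [L]: with [b = 0] it makes every non-zero lattice
vector parallel to [v1] at least [r] long. *)
Definition separated L r v1 v2 := forall a b : R, L (a *: v1) -> L (b *: v2) ->
  enorm (a *: v1 - b *: v2) < r -> a = 0 /\ b = 0.

(** In the coordinates given by a basis, the vectors [(1, M)] and [(- M, 1)] are
orthogonal and each is primitive; they span a sublattice which is the lattice of
integer points rotated and stretched by the square root of [1 + M^2]. *)
Lemma separated_exists L r : (2 <= d)%N -> full_lattice L ->
  exists v1 v2, [/\ L v1, L v2 & separated L r v1 v2].
Proof.
move=> hd [B Bu ->].
have [C C0 CP] := mulmx_coord_le (invmx B).
set M : nat := Num.bound (2 * (C * `|r|)).
pose i0 : 'I_d := Ordinal (ltnW hd); pose i1 : 'I_d := Ordinal hd.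
pose z (p q : int) : 'rV[int]_d := p *: delta_mx 0 i0 + q *: delta_mx 0 i1.
pose vec p q : 'rV[R]_d := map_mx intr (z p q) *m B.
have z0 p q : z p q 0 i0 = p by rewrite !mxE /= !mulr1 mulr0 addr0.
have z1 p q : z p q 0 i1 = q by rewrite !mxE /= mulr1 mulr0 add0r.
exists (vec 1 M%:Z), (vec (- M%:Z) 1); split.
- by exists (z 1 M%:Z).
- by exists (z (- M%:Z) 1).
move=> a b [za _ zaE] [zb _ zbE] lt_r.
have c0 k p q : (k *: vec p q *m invmx B) 0 i0 = k * p%:~R.
  by rewrite -scalemxAl mulmxK // mxE [_ 0 i0]mxE z0.
have c1 k p q : (k *: vec p q *m invmx B) 0 i1 = k * q%:~R.
  by rewrite -scalemxAl mulmxK // mxE [_ 0 i1]mxE z1.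
(* The coordinate equal to 1 in each vector forces [a] and [b] to be integers. *)
have := c0 a 1 M%:Z; rewrite -zaE mulmxK // mxE mulr1.
set p := za 0 i0 => pa.
have := c1 b (- M%:Z) 1; rewrite -zbE mulmxK // mxE mulr1.
set q := zb 0 i1 => qb.
have cle j : `|((a *: vec 1 M%:Z - b *: vec (- M%:Z) 1) *m invmx B) 0 j|
    <= C * `|r|.
  apply: le_trans (CP _ _) _; apply: ler_wpM2l => //.
  exact/ltW/(lt_le_trans lt_r)/ler_norm.
have cB (x y : 'rV[R]_d) j : (x - y) 0 j = x 0 j - y 0 j by rewrite !mxE.
have := cle i0; have := cle i1.
rewrite mulmxBl !cB !c0 !c1 mulrNz mulrN opprK !mulr1 -pa -qb -pmulrn.
have : 2 * (C * `|r|) < M%:R by apply: archi_boundP; rewrite !mulr_ge0.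
have : 0 <= C * `|r| by rewrite mulr_ge0.
move: (C * `|r|) M%:R => K m K0 Km.
rewrite !ler_norml => /andP[l1 u1] /andP[l0 u0].
have pq0 : p ^+ 2 + q ^+ 2 = 0.
  have pq_ge0 : 0 <= p ^+ 2 + q ^+ 2 by rewrite addr_ge0 ?sqr_ge0.
  apply/eqP; rewrite eq_le pq_ge0 andbT leNgt; apply/negP => pq_gt0.
  have pq1 : 1 <= p%:~R ^+ 2 + q%:~R ^+ 2 :> R.
    by rewrite -!rmorphXn -rmorphD /= -[1]/(1%:~R) ler_int.
  move: (p%:~R) (q%:~R) pq1 l0 u0 l1 u1 => {pa qb} P Q PQ l0 u0 l1 u1.
  (* [1 + m^2 <= (P^2 + Q^2) (1 + m^2) <= 2 K^2], against [2 K < m]. *)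
  nra.
move/eqP: pq0; rewrite paddr_eq0 ?sqr_ge0 // !sqrf_eq0 => /andP[].
by move=> /eqP -> /eqP ->.
Qed.

(** * Determination by a separated pair *)

Section Determination.
Variables (L : set 'rV[R]_d) (t : 'rV[R]_d) (r : R) (v1 v2 : 'rV[R]_d).
Hypotheses (hL : full_lattice L) (r_gt0 : 0 < r).
Hypotheses (Lv1 : L v1) (Lv2 : L v2) (sep : separated L r v1 v2).

(** The two shifts of [x] are compared with each other, inside [F'], and never
across [F] and [F']. *)
Lemma separated_sub F F' :
  diam_lt r (translate t L) F -> diam_lt r (translate t L) F' ->
  (forall x, F x -> exists c : R, F' (x + c *: v1)) ->
  (forall x, F x -> exists c : R, F' (x + c *: v2)) -> F `<=` F'.
Proof.
move=> [Ft _] [F't F'r] FF'1 FF'2 x Fx.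
have [a F'a] := FF'1 _ Fx; have [b F'b] := FF'2 _ Fx.
have inL w : F' (x + w) -> L w.
  move=> F'w; have [y Ly yx] := Ft _ Fx; have [y' Ly' yx'] := F't _ F'w.
  suff -> : w = y' - y by exact: full_latticeB.
  by apply: (addrI x); rewrite -yx' -yx addrACA subrr addr0.
have [|a0 _] := sep (inL _ F'a) (inL _ F'b).
  have := enorm_lt_diam F'r F'a F'b.
  by rewrite opprD addrACA subrr add0r.
by move: F'a; rewrite a0 scale0r addr0.
Qed.

(** If [v1 = c *: v2], then [a = 1] and [b = c] contradict separation, the
difference being zero. *)
Lemma separated_not_colinear (c : R) : v1 <> c *: v2 /\ v2 <> c *: v1.
Proof.
have n1 : (1 : R) <> 0 by move/eqP; rewrite oner_eq0.
split=> vE.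
  have [] : (1 : R) = 0 /\ c = 0; last by [].
  by apply: sep; rewrite ?scale1r -?vE ?subrr ?enorm0.
have [] : c = 0 /\ (1 : R) = 0; last by [].
by apply: sep; rewrite ?scale1r -?vE ?subrr ?enorm0.
Qed.

Lemma separated_neq0 : v1 != 0 /\ v2 != 0.
Proof.
split; apply/eqP => v0; have [] := separated_not_colinear 0;
  by rewrite !scale0r.
Qed.

Let fin F (DF : diam_lt r (translate t L) F) : finite_set F :=
  finite_diam_lt hL DF.

Lemma separated_xrays :
  determined_by_xrays L (diam_lt r (translate t L)) 2.
Proof.
have [v10 v20] := separated_neq0; have ncol := separated_not_colinear.
split=> //; pose n (v : 'rV[R]_d) := (enorm v)^-1 *: v.
have n_colinear v (c : R) w : v != 0 -> n v = c *: n w ->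
    exists k : R, v = k *: w.
  move=> v0 /(congr1 ( *:%R (enorm v))).
  rewrite !scalerA divff ?enorm_neq0 // scale1r => ->.
  by eexists.
have n12 : n v1 != n v2.
  apply/eqP => nE; have [|k vE] := @n_colinear v1 1 v2 v10.
    by rewrite scale1r.
  by have [] := ncol k.
exists [set n v1; n v2]; split.
- exact: card_eq_set2.
- have nL v : L v -> v != 0 -> L_direction L (n v).
    move=> Lv v0; split; first exact: enorm_normalize.
    exists v; split=> //.
    by exists (enorm v)^-1; rewrite ?invr_eq0 ?enorm_neq0.
  by move=> u [] ->; exact: nL.
- move=> u v [] -> [] ->; rewrite ?eqxx // => _ [c _ /n_colinear[//|k vE]].
    by have [] := ncol k.
  by have [] := ncol k.
- move=> F F' DF DF' FF'.
  have shift G G' v : diam_lt r (translate t L) G ->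
      diam_lt r (translate t L) G' -> xray (u := n v) G = xray G' ->
      forall x, G x -> exists c : R, G' (x + c *: v).
    move=> DG DG' GG' x /(eq_xray (fin DG) (fin DG') GG')[c].
    by rewrite scalerA; eexists; eassumption.
  have F1 := FF' (n v1) (or_introl erefl).
  have F2 := FF' (n v2) (or_intror erefl).
  by apply/seteqP; split; apply: separated_sub => //; apply: shift.
Qed.

Lemma separated_projections :
  determined_by_projections L (diam_lt r (translate t L)) 2.
Proof.
have [v10 v20] := separated_neq0; have ncol := separated_not_colinear.
split=> //.
have n12 : ~ (<[v1]> <= <[v2]>)%VS.
  by rewrite -memvE => /vlineP[k]; have [] := ncol k.
have n21 : ~ (<[v2]> <= <[v1]>)%VS.
  by rewrite -memvE => /vlineP[k]; have [] := ncol k.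
exists [set <[v1]>%VS; <[v2]>%VS]; split.
- by apply: card_eq_set2; apply/eqP => vE; apply: n12; rewrite vE.
- have gen v : L v -> v != 0 ->
      \dim <[v]> = 1%N /\ subspace_generated_by L <[v]>.
    move=> Lv v0; split; first by rewrite dim_vline v0.
    by exists [:: v]; [move=> x; rewrite inE => /eqP ->|rewrite span_seq1].
  by move=> T [] ->; exact: gen.
- by move=> T T' [] -> [] ->; rewrite ?eqxx // => _ [].
- move=> F F' DF DF' FF'.
  have F1 := FF' _ (or_introl erefl); have F2 := FF' _ (or_intror erefl).
  by apply/seteqP; split; apply: separated_sub => // x;
    apply: eq_orth_proj_line.
Qed.

End Determination.
End Lattice.

Theorem corollary12 (R : realType) (d : nat) (t : 'rV[R]_d)
    (L : set 'rV[R]_d) (r : R) (hd : (2 <= d)%N) (hL : full_lattice L)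
    (hr : 0 < r) :
  determined_by_xrays L (diam_lt r (translate t L)) 2 /\
  determined_by_projections L (diam_lt r (translate t L)) 2.
Proof.
have [v1 [v2 [Lv1 Lv2 sep]]] := separated_exists r hd hL.
split; [exact: separated_xrays sep|exact: separated_projections sep].
Qed.
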